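(* Let $q,\beta>0$, $0<\alpha<1$, $n\in\mathbb{N}$ with $n^{1-\alpha}>2$, $r\in\mathbb{N}$, and $f\in C_B(\mathbb{R})$. Let $M\in\mathbb{N}$ and weights $w_1,\dots,w_M\ge0$ with $\sum_{j=1}^M w_j=1$ be given (used to define $\overline{B_n}$). Then: (i) $$\|B_n^r(f)-f\|_\infty\le r\|B_n(f)-f\|_\infty\le r\left[\omega\left(f,\frac1{n^\alpha}\right)+\frac{2\left(q+\frac1q\right)\|f\|_\infty}{e^{\beta(n^{1-\alpha}-1)}}\right],$$ (ii) $$\|(B_n^{*})^{r}(f)-f\|_\infty\le r\|B_n^*(f)-f\|_\infty\le r\left[\omega\left(f,\frac1n+\frac1{n^\alpha}\right)+\frac{2\left(q+\frac1q\right)\|f\|_\infty}{e^{\beta(n^{1-\alpha}-1)}}\right],$$ (iii) $$\|\overline{B_n}^{\,r}(f)-f\|_\infty\le r\|\overline{B_n}(f)-f\|_\infty\le r\left[\omega\left(f,\frac1n+\frac1{n^\alpha}\right)+\frac{2\left(q+\frac1q\right)\|f\|_\infty}{e^{\beta(n^{1-\alpha}-1)}}\right].$$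
   Context: $\mathbb{N}=\{1,2,\dots\}$. For $q,\beta>0$ and $x\in\mathbb{R}$ let $\nu_{q}(x)=\frac{1-qe^{-\beta x}}{1+qe^{-\beta x}}$ and $G_{q,\beta}(x)=\frac14\left(\nu_{q}(x+1)-\nu_{q}(x-1)\right)$; $G_{1/q,\beta}$ is the same with $q$ replaced by $1/q$. Let $\Psi=\frac12\left(G_{q,\beta}+G_{1/q,\beta}\right)$ (an even probability density on $\mathbb{R}$). $C_B(\mathbb{R})$ is the set of continuous bounded real functions on $\mathbb{R}$, with supremum norm $\|\cdot\|_\infty$. For $\theta>0$, $\omega(f,\theta)=\sup\{|f(x)-f(y)|: x,y\in\mathbb{R},\ |x-y|\le\theta\}$. The operators are $$B_n(f)(x)=\int_{-\infty}^{\infty}f\left(\frac vn\right)\Psi(nx-v)\,dv,$$ $$B_n^*(f)(x)=n\int_{-\infty}^{\infty}\left(\int_0^{1/n}f\left(h+\frac vn\right)dh\right)\Psi(nx-v)\,dv,$$ $$\overline{B_n}(f)(x)=\int_{-\infty}^{\infty}\left(\sum_{j=1}^M w_j f\left(\frac vn+\frac{j}{nM}\right)\right)\Psi(nx-v)\,dv .$$ They map $C_B(\mathbb{R})$ into itself. For such an operator $L$, $L^r$ denotes its $r$-fold composition. *)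

(* Defs.v *)
From HB Require Import structures.
From mathcomp Require Import all_boot all_order all_algebra.
From mathcomp Require Import all_classical all_reals all_analysis.
Set Implicit Arguments.
Unset Strict Implicit.
Unset Printing Implicit Defensive.
Import Order.TTheory GRing.Theory Num.Theory.
Import numFieldNormedType.Exports.
Local Open Scope classical_set_scope.
Local Open Scope ring_scope.

Definition nu (R : realType) (q beta x : R) : R :=
  (1 - q * expR (- (beta * x))) / (1 + q * expR (- (beta * x))).

Definition G (R : realType) (q beta x : R) : R :=
  4^-1 * (nu q beta (x + 1) - nu q beta (x - 1)).

Definition Psi (R : realType) (q beta x : R) : R :=
  2^-1 * (G q beta x + G q^-1 beta x).

(* Integrals are real-valued Lebesgue integrals; the integrands below are
   continuous and absolutely integrable when f is continuous and bounded, so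
   these agree with the (improper) Riemann integrals. *)

Definition Bop (R : realType) (q beta : R) (n : nat) (f : R -> R) : R -> R :=
  fun x => \int[lebesgue_measure]_v (f (v / n%:R) * Psi q beta (n%:R * x - v)).

Definition Bstar (R : realType) (q beta : R) (n : nat) (f : R -> R) : R -> R :=
  fun x => n%:R * \int[lebesgue_measure]_v
    ((\int[lebesgue_measure]_(h in `[0, n%:R^-1]) f (h + v / n%:R))
     * Psi q beta (n%:R * x - v)).

(* The weight written w_j for 1 <= j <= M is w applied to the ordinal j - 1. *)
Definition Bbar (R : realType) (q beta : R) (M : nat) (w : 'I_M -> R) (n : nat)
    (f : R -> R) : R -> R :=
  fun x => \int[lebesgue_measure]_v
    ((\sum_(j < M) w j * f (v / n%:R + j.+1%:R / (n%:R * M%:R)))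
     * Psi q beta (n%:R * x - v)).

(* The real-valued sup has the junk value 0 on sets without an upper bound; the
   two suprema below are meaningful for bounded functions only. *)

Definition sup_norm (R : realType) (f : R -> R) : R :=
  sup [set `|f x| | x in [set: R]].

Definition modulus (R : realType) (f : R -> R) (theta : R) : R :=
  sup [set z : R | exists x y : R, `|x - y| <= theta /\ z = `|f x - f y|].

(* Main.v *)
(** Each operator has the form [f |-> Bop (S f)], where [S f y] is an average
    of [f] over [[y, y + delta]] ([S] is the identity for [Bop] itself).
    Reflection invariance of Lebesgue measure turns [Bop g x] into the integral
    of [g (x - u / n) * Psi u]; as [Psi] is a probability density, [Bop] is a
    linear contraction preserving bounded continuity, and the bound for the
    r-th iterate follows by telescoping.  The rate comes from splitting the
    integral of [(f - f x) * Psi] at [|u| = T = n^(1 - alpha)]: the inner part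
    is controlled by the modulus of continuity.  For the outer part, [G q] has
    the explicit primitive
    [(2 beta)^-1 ln ((1 + q e^(-beta(x+1))) / (1 + q e^(-beta(x-1))))], which
    vanishes at infinity, so that [Psi] has mass at most
    [(q + 1/q) e^(-beta(T-1))] outside [[-T, T]]. *)
Require Import Defs.
From HB Require Import structures.
From mathcomp Require Import all_boot all_order all_algebra.
From mathcomp Require Import all_classical all_reals all_analysis.
From mathcomp Require Import measurable_realfun ring lra.
Set Implicit Arguments.
Unset Strict Implicit.
Unset Printing Implicit Defensive.
Import Order.TTheory GRing.Theory Num.Theory.
Import numFieldNormedType.Exports.
Local Open Scope classical_set_scope.
Local Open Scope ring_scope.

(** * Reflection invariance of the Lebesgue integral *)

(** The map v |-> c - v pushes Lebesgue measure forward to itself; splitting [g] into positive and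
    negative parts reduces the claim to the change of variables for nonnegative functions. *)
Lemma Rintegral_reflect (R : realType) (g : R -> R) (c : R) :
  measurable_fun setT g ->
  \int[lebesgue_measure]_v g (c - v) = \int[lebesgue_measure]_v g v.
Proof.
move=> mg; pose phi (v : measurableTypeR R) : measurableTypeR R := c - v.
have mphi : measurable_fun setT phi.
  apply: continuous_measurable_fun => x.
  by apply: cvgB; [exact: cvg_cst|exact: cvg_id].
have phiE A : measurable A ->
    lebesgue_measure A = pushforward lebesgue_measure phi A.
  (* Lebesgue measure is determined by its values on the intervals ]a, b], whose preimages are the
     intervals [c - b, c - a[. *)
  move=> mA; apply: lebesgue_measure_unique => // _ [[a b]] _ <-.
  transitivity (lebesgue_measure (`[c - b, c - a[%classic : set R)); last first.
    rewrite /pushforward; congr (lebesgue_measure _).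
    by apply/seteqP; split => x; rewrite /phi /= !in_itv/=; lra.
  rewrite /= !lebesgue_measure_itv/= !lte_fin -!EFinD.
  have -> : (c - b < c - a) = (a < b) by apply/idP/idP; lra.
  by case: ifPn => // _; congr EFin; lra.
have push (h : R -> \bar R) : measurable_fun setT h -> (forall x, 0 <= h x)%E ->
    (\int[lebesgue_measure]_v h (c - v)%R = \int[lebesgue_measure]_v h v)%E.
  move=> mh h0; transitivity (\int[pushforward lebesgue_measure phi]_v h v)%E.
    by rewrite ge0_integral_pushforward.
  by apply: eq_measure_integral => A mA _; exact/esym/phiE.
rewrite /Rintegral; congr fine; rewrite integralE [RHS]integralE.
have mgE : measurable_fun setT (EFin \o g) by exact/measurable_EFinP.
congr (_ - _)%E.
- rewrite -[RHS](push _ (measurable_funepos mgE) (funepos_ge0 _)).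
  by apply: eq_integral => v _; rewrite !funeposE.
- rewrite -[RHS](push _ (measurable_funeneg mgE) (funeneg_ge0 _)).
  by apply: eq_integral => v _; rewrite !funenegE.
Qed.

(** * The functions [nu] and [G], and an explicit primitive of [G] *)

Section density.
Context (R : realType) (q beta : R).
Hypotheses (q0 : 0 < q) (beta0 : 0 < beta).

Let den (x : R) : R := 1 + q * expR (- (beta * x)).

Let den_gt0 x : 0 < den x.
Proof. by rewrite ltr_wpDr// mulr_ge0 ?expR_ge0// ltW. Qed.

(** With x occurring only in the denominator, sign and continuity questions reduce to [den]. *)
Lemma nuE (x : R) : nu q beta x = 2 / (1 + q * expR (- (beta * x))) - 1.
Proof. by rewrite /nu; field; rewrite gt_eqF// den_gt0. Qed.

(** Multiply numerator and denominator by q^-1 e^(-beta x). This exchange of q and 1/q is what makes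
    [Psi] even. *)
Lemma nu_opp (x : R) : nu q beta (- x) = - nu q^-1 beta x.
Proof.
rewrite /nu mulrN opprK expRN.
have e0 := expR_gt0 (beta * x).
have d1 : 0 < 1 + q * expR (beta * x) by rewrite addr_gt0// mulr_gt0.
by field; rewrite !gt_eqF//= addrC.
Qed.

Lemma G_opp (x : R) : G q beta (- x) = G q^-1 beta x.
Proof.
rewrite /G (_ : - x + 1 = - (x - 1)); last ring.
rewrite (_ : - x - 1 = - (x + 1)); last ring.
by rewrite !nu_opp; congr (_ * _); ring.
Qed.

Lemma G_ge0 (x : R) : 0 <= G q beta x.
Proof.
rewrite /G !nuE mulr_ge0//.
have /andP[d1 d2] : (0 < den (x + 1)) && (0 < den (x - 1)) by rewrite !den_gt0.
suff : (den (x - 1))^-1 <= (den (x + 1))^-1 by rewrite /den; lra.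
rewrite lef_pV2 ?posrE// lerD2l ler_pM2l// ler_expR lerN2 ler_pM2l//; lra.
Qed.

Let den_continuous : continuous den.
Proof.
move=> x; apply: cvgD; first exact: cvg_cst.
apply: cvgM; first exact: cvg_cst.
apply: continuous_comp; last exact: continuous_expR.
by apply: cvgN; apply: cvgM; [exact: cvg_cst|exact: cvg_id].
Qed.

Lemma nu_continuous : continuous (nu q beta).
Proof.
move=> x; rewrite (_ : nu q beta = fun x => 2 / den x - 1); last first.
  by apply/funext => y; rewrite nuE.
apply: cvgB; last exact: cvg_cst.
apply: cvgM; first exact: cvg_cst.
by apply: cvgV; [rewrite gt_eqF|exact: den_continuous].
Qed.

Lemma G_continuous : continuous (G q beta).
Proof.
move=> x; apply: cvgM; first exact: cvg_cst.
have cnu c : nu q beta (y + c) @[y --> x] --> nu q beta (x + c).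
  apply: (@cvg_comp _ _ _ (+%R^~ c) (nu q beta)); last exact: nu_continuous.
  by apply: cvgD; [exact: cvg_id|exact: cvg_cst].
by apply: cvgB; exact: cnu.
Qed.

(** Since nu = 1 + (2 / beta) (ln den)', the constant 1 cancels in nu (x + 1) - nu (x - 1), and the
    factor is 1/4 times 2 / beta. *)
Definition G_primitive (x : R) : R :=
  (2 * beta)^-1 * (ln (den (x + 1)) - ln (den (x - 1))).

Lemma is_derive_G_primitive (x : R) :
  is_derive x 1 G_primitive (G q beta x).
Proof.
have dln c : is_derive x 1 (fun y => ln (den (y + c)))
    (- (beta * (q * expR (- (beta * (x + c))))) / den (x + c)).
  have dd : is_derive x 1 (fun y => den (y + c))
      (- (beta * (q * expR (- (beta * (x + c)))))).
    have de : is_derive x 1 (fun y => expR (- (beta * (y + c))))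
        (expR (- (beta * (x + c))) * - beta).
      apply: (@is_derive1_comp _ expR (fun y => - (beta * (y + c)))).
      by apply: is_derive_eq; rewrite addr0 /GRing.scale /= mulr1.
    by apply: is_derive_eq; rewrite /GRing.scale /=; ring.
  rewrite mulrC.
  exact: (@is_derive1_comp _ (@ln R) (fun y => den (y + c)) x _ _
            (is_derive1_ln (den_gt0 _)) dd).
have d1 := dln 1; have d2 := dln (- 1).
apply: is_derive_eq.
rewrite /GRing.scale /= /G !nuE -/(den (x + 1)) -/(den (x - 1)).
(* Eliminating the exponentials leaves a rational identity in [den (x + 1)] and [den (x - 1)]. *)
have eE c : q * expR (- (beta * c)) = den c - 1 by rewrite /den; ring.
rewrite !eE.
by field; rewrite !gt_eqF.
Qed.

Lemma G_primitive_cvg : G_primitive x @[x --> +oo] --> (0 : R).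
Proof.
have hden c : den (x + c) @[x --> +oo] --> (1 : R).
  rewrite -[X in _ --> X]addr0 -(mulr0 q) /den.
  apply: cvgD; first exact: cvg_cst.
  apply: cvgM; first exact: cvg_cst.
  apply: (@cvg_comp _ _ _ (fun x => beta * (x + c)) (fun y => expR (- y))).
    exact: gt0_cvgMry (cvg_addrr c).
  exact: cvgr_expR.
have hln c : ln (den (x + c)) @[x --> +oo] --> (0 : R).
  rewrite -ln1; apply: continuous_cvg; last exact: hden.
  exact: continuous_ln.
rewrite /G_primitive -[X in _ --> X](mulr0 (2 * beta)^-1) -(subr0 0).
apply: cvgM; first exact: cvg_cst.
by apply: cvgB; apply: hln.
Qed.

Lemma G_integral_itvcy (a : R) :
  (\int[lebesgue_measure]_(x in `[a, +oo[) (G q beta x)%:E =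
   (- G_primitive a)%:E)%E.
Proof.
rewrite (@ge0_continuous_FTC2y _ _ G_primitive a 0).
- by rewrite sub0e.
- by move=> x _; exact: G_ge0.
- by apply: continuous_subspaceT; exact: G_continuous.
- exact: G_primitive_cvg.
- by move=> x _; have [] := is_derive_G_primitive x.
- apply: cvg_at_right_filter.
  apply: differentiable_continuous; apply/derivable1_diffP.
  by have [] := is_derive_G_primitive a.
- by move=> x _; rewrite derive1E; have [] := is_derive_G_primitive x.
Qed.

(** Two linearisations: ln s - ln t <= s - t for s >= t >= 1, and 1 - e^(-2 beta) <= 2 beta. The
    second produces the factor that cancels (2 beta)^-1. *)
Lemma G_primitive_le (a : R) :
  - G_primitive a <= q * expR (- (beta * (a - 1))).
Proof.
have /andP[d1 d2] : (0 < den (a + 1)) && (0 < den (a - 1)) by rewrite !den_gt0.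
have dE c : q * expR (- (beta * c)) = den c - 1 by rewrite /den; ring.
have h1 : ln (den (a - 1)) - ln (den (a + 1)) <= den (a - 1) - den (a + 1).
  rewrite -ln_div ?posrE//.
  have -> : den (a - 1) / den (a + 1) =
      1 + (den (a - 1) - den (a + 1)) / den (a + 1).
    by field; rewrite gt_eqF.
  have ge0 : den (a + 1) <= den (a - 1).
    by rewrite lerD2l ler_pM2l// ler_expR lerN2 ler_pM2l//; lra.
  apply: (le_trans (le_ln1Dx _)).
    by rewrite (lt_le_trans (ltrN10 _))// divr_ge0 ?subr_ge0// ltW.
  (* The denominator [den (a + 1)] is at least 1, so dropping it only enlarges the quotient. *)
  rewrite ler_pdivrMr// ler_peMr ?subr_ge0//.
  by rewrite lerDl mulr_ge0 ?expR_ge0// ltW.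
have h2 : den (a - 1) - den (a + 1) <= 2 * beta * (q * expR (- (beta * (a - 1)))).
  have -> : den (a + 1) =
      1 + q * expR (- (beta * (a - 1))) * expR (- (2 * beta)).
    by rewrite /den -mulrA -expRD; congr (1 + q * expR _); ring.
  have := expR_ge1Dx (- (2 * beta)).
  have : 0 <= q * expR (- (beta * (a - 1))) by rewrite mulr_ge0 ?expR_ge0// ltW.
  by rewrite /den; nra.
rewrite /G_primitive -mulrN opprB ler_pdivrMl ?mulr_gt0//.
exact: le_trans h1 h2.
Qed.

End density.

(** * The density [Psi]: symmetry, total mass and tails *)

Section Psi_theory.
Context (R : realType) (q beta : R).
Hypotheses (q0 : 0 < q) (beta0 : 0 < beta).

Let qV0 : 0 < q^-1. Proof. by rewrite invr_gt0. Qed.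

Lemma Psi_ge0 (x : R) : 0 <= Psi q beta x.
Proof. by rewrite /Psi mulr_ge0// addr_ge0// G_ge0. Qed.

Lemma Psi_even (x : R) : Psi q beta (- x) = Psi q beta x.
Proof. by rewrite /Psi !G_opp// invrK addrC. Qed.

Lemma Psi_continuous : continuous (Psi q beta).
Proof.
move=> x; apply: cvgM; first exact: cvg_cst.
by apply: cvgD; exact: G_continuous.
Qed.

Lemma Psi_measurable : measurable_fun setT (Psi q beta).
Proof. exact: continuous_measurable_fun Psi_continuous. Qed.

Lemma Psi_integral_itvcy (a : R) :
  (\int[lebesgue_measure]_(x in `[a, +oo[) (Psi q beta x)%:E =
   (- (2^-1 * (G_primitive q beta a + G_primitive q^-1 beta a)))%:E)%E.
Proof.
have mG p : 0 < p -> measurable_fun `[a, +oo[ (EFin \o G p beta).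
  move=> p0; apply/measurable_EFinP; apply: measurable_funTS.
  by apply: continuous_measurable_fun; exact: G_continuous.
under eq_integral do rewrite EFinM EFinD.
rewrite ge0_integralZl//=; last 2 first.
- by apply: emeasurable_funD; exact: mG.
- by move=> x _; rewrite -EFinD lee_fin addr_ge0// G_ge0.
rewrite ge0_integralD//=; last 4 first.
- by move=> x _; rewrite lee_fin G_ge0.
- exact: mG.
- by move=> x _; rewrite lee_fin G_ge0.
- exact: mG.
by rewrite !G_integral_itvcy// -EFinD -EFinM; congr EFin; ring.
Qed.

Lemma Psi_integral :
  (\int[lebesgue_measure]_x (Psi q beta x)%:E = 1)%E.
Proof.
rewrite ge0_symfun_integralT; last 3 first.
- exact: Psi_ge0.
- exact: Psi_continuous.
- by move=> x /=; rewrite Psi_even.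
rewrite -set_itvcy Psi_integral_itvcy -EFinM; congr EFin.
rewrite /G_primitive !(add0r, sub0r).
set a := 1 + q * expR (- (beta * 1)); set b := 1 + q * expR (- (beta * -1)).
set c := 1 + q^-1 * expR (- (beta * 1)); set d := 1 + q^-1 * expR (- (beta * -1)).
have [a0 b0 c0 d0] : [/\ 0 < a, 0 < b, 0 < c & 0 < d].
  by split; rewrite addr_gt0// mulr_gt0 ?expR_gt0.
(* From b = q e^beta c and d = q^-1 e^beta a follows b d = e^(2 beta) a c: q cancels thanks to the
   averaging over q and 1/q. *)
have : ln (b * d) = 2 * beta + ln (a * c).
  rewrite -{1}(expRK (2 * beta)) -lnM ?posrE ?expR_gt0 ?mulr_gt0//.
  congr ln; rewrite /a /b /c /d !mulrN !mulr1 opprK expRN.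
  rewrite mulr_natl mulr2n expRD.
  by field; rewrite !gt_eqF// expR_gt0.
rewrite !lnM ?posrE// => h.
rewrite -mulrDr.
rewrite (_ : ln a - ln b + (ln c - ln d) = - (2 * beta)).
  by field; rewrite gt_eqF.
by apply/eqP; rewrite eq_sym -subr_eq0; apply/eqP; lra.
Qed.

Lemma Psi_integrable : lebesgue_measure.-integrable setT (EFin \o Psi q beta).
Proof.
apply/integrableP; split.
  by apply/measurable_EFinP; exact: Psi_measurable.
under eq_integral do rewrite gee0_abs ?lee_fin ?Psi_ge0//.
by rewrite Psi_integral ltry.
Qed.

Lemma Psi_Rintegral : \int[lebesgue_measure]_x Psi q beta x = 1.
Proof. by rewrite /Rintegral Psi_integral. Qed.

(** The factor 2, which stands for the two symmetric tails, cancels the 1/2 in [Psi]; the bounds for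
    q and 1/q then add up. *)
Lemma Psi_tail (a : R) :
  2 * \int[lebesgue_measure]_(x in `[a, +oo[) Psi q beta x <=
  (q + q^-1) * expR (- (beta * (a - 1))).
Proof.
rewrite /Rintegral Psi_integral_itvcy /=.
have := G_primitive_le q0 beta0 a; have := G_primitive_le qV0 beta0 a.
by lra.
Qed.

End Psi_theory.

(** * Bounded continuous functions, supremum norm and modulus of continuity *)

Definition bounded_continuous (R : realType) (f : R -> R) : Prop :=
  continuous f /\ exists M, forall x, `|f x| <= M.

Section sup_norm_theory.
Context (R : realType).
Implicit Types f g : R -> R.

Lemma ler_sup_norm f (x : R) : (exists M, forall y, `|f y| <= M) ->
  `|f x| <= sup_norm f.
Proof.
by move=> [M fM]; apply: ub_le_sup; [exists M => _ [y _ <-]|exists x].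
Qed.

Lemma sup_norm_le f (c : R) : (forall x, `|f x| <= c) -> sup_norm f <= c.
Proof.
move=> fc; apply: ge_sup; first by exists `|f 0|, 0.
by move=> _ [x _ <-].
Qed.

Lemma ler_modulus f (theta x y : R) : (exists M, forall y, `|f y| <= M) ->
  `|x - y| <= theta -> `|f x - f y| <= modulus f theta.
Proof.
move=> [M fM] xy; apply: ub_le_sup; last by exists x, y.
by exists (M + M) => _ [a [b [_ ->]]]; rewrite (le_trans (ler_normB _ _)) ?lerD.
Qed.

Lemma bounded_continuousB f g : bounded_continuous f -> bounded_continuous g ->
  bounded_continuous (f \- g).
Proof.
move=> [cf [M fM]] [cg [N gN]]; split.
  by move=> x; apply: cvgB; [exact: cf|exact: cg].
by exists (M + N) => x; rewrite (le_trans (ler_normB _ _)) ?lerD.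
Qed.

(** Induction on r through L^(r+1) f - f = L (L^r f - f) + (L f - f), where contraction hands the
    first term over to the induction hypothesis. *)
Lemma sup_norm_iter_le (L : (R -> R) -> R -> R) f (r : nat) :
  (forall g, bounded_continuous g -> bounded_continuous (L g)) ->
  (forall g h, bounded_continuous g -> bounded_continuous h ->
    L (g \- h) = L g \- L h) ->
  (forall g, bounded_continuous g -> sup_norm (L g) <= sup_norm g) ->
  bounded_continuous f ->
  sup_norm (iter r L f \- f) <= r%:R * sup_norm (L f \- f).
Proof.
move=> LC LB Lle fC.
have iC k : bounded_continuous (iter k L f) by elim: k => //= k; exact: LC.
have dC := bounded_continuousB (LC _ fC) fC.
elim: r => [|r IHr].
  by rewrite mul0r; apply: sup_norm_le => x /=; rewrite subrr normr0.
have dkC := bounded_continuousB (iC r) fC.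
apply: sup_norm_le => x.
have -> : (iter r.+1 L f \- f) x = L (iter r L f \- f) x + (L f \- f) x.
  by rewrite LB//=; ring.
rewrite (le_trans (ler_normD _ _))// -natr1 mulrDl mul1r lerD//.
  rewrite (le_trans (ler_sup_norm _ _))//; first by case: (LC _ dkC).
  by rewrite (le_trans (Lle _ dkC)).
by apply: ler_sup_norm; case: dC.
Qed.

End sup_norm_theory.

(** * Forward averages: identity, weighted sums and running means *)

Section forward_average.
Context (R : realType).
Implicit Types g h : R -> R.
Local Notation mu := (@lebesgue_measure R).

(* [S g y] is an average of [g] over [y, y + delta]. *)
Definition forward_average (delta : R) (S : (R -> R) -> R -> R) : Prop :=
  [/\ forall g, bounded_continuous g -> continuous (S g),
      forall g h, bounded_continuous g -> bounded_continuous h ->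
        S (g \- h) = S g \- S h
    & forall g (c e y : R), bounded_continuous g ->
        (forall t, 0 <= t <= delta -> `|g (y + t) - c| <= e) ->
        `|S g y - c| <= e].

Lemma forward_average_id : forward_average 0 idfun.
Proof.
split=> //; first by move=> g [].
by move=> g c e y _ /(_ 0); rewrite addr0; apply; rewrite lexx.
Qed.

Variable n : nat.
Hypothesis n0 : (0 < n)%N.

Let nR0 : 0 < n%:R :> R. Proof. by rewrite ltr0n. Qed.

Lemma forward_average_sum (M : nat) (w : 'I_M -> R) : (0 < M)%N ->
  (forall j, 0 <= w j) -> \sum_(j < M) w j = 1 ->
  forward_average n%:R^-1
    (fun g y => \sum_(j < M) w j * g (y + j.+1%:R / (n%:R * M%:R))).
Proof.
move=> M0 w0 w1; have MR0 : 0 < M%:R :> R by rewrite ltr0n.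
split.
- move=> g [cg _] y; apply: cvg_big => [|j _]; first exact: add_continuous.
  apply: cvgM; first exact: cvg_cst.
  apply: (@cvg_comp _ _ _ (fun y => y + j.+1%:R / (n%:R * M%:R)) g);
    last exact: cg.
  by apply: cvgD; [exact: cvg_id|exact: cvg_cst].
- move=> g h _ _; apply/funext => y /=; rewrite -sumrB.
  by apply: eq_bigr => j _; rewrite mulrBr.
- move=> g c e y _ gce.
  (* The constants c and e become weighted sums themselves, so that the comparison is termwise. *)
  have wE a : a = \sum_(j < M) w j * a by rewrite -mulr_suml w1 mul1r.
  rewrite [c]wE [leRHS]wE -sumrB.
  apply: (le_trans (ler_norm_sum _ _ _)).
  apply: ler_sum => j _; rewrite -mulrBr normrM (ger0_norm (w0 j)) ler_wpM2l//.
  have nM0 : 0 < n%:R * M%:R :> R by rewrite mulr_gt0.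
  (* Since j < M, the shifted index [j.+1] is at most M and the node lies in [0, 1/n]. *)
  apply: gce; rewrite divr_ge0 ?ler0n ?(ltW nM0)//=.
  by rewrite ler_pdivrMr// mulrA mulVf ?gt_eqF// mul1r ler_nat.
Qed.

(** The factor n, outside the outer integral in [Bstar], is attached to the inner one here so that
    constants are preserved; [BstarE] reconciles the two forms. *)
Definition running_mean g (y : R) : R :=
  n%:R * \int[mu]_(h in `[0, n%:R^-1]) g (h + y).

Let mI : measurable (`[0, n%:R^-1] : set (measurableTypeR R)).
Proof. exact: measurable_itv. Qed.

Let integrable_shift g (y : R) : continuous g ->
  mu.-integrable `[0, n%:R^-1] (EFin \o (fun h : R => g (h + y))).
Proof.
move=> cg; have cgy : continuous (fun h : R => g (h + y)).
  move=> h; apply: (@cvg_comp _ _ _ (+%R^~ y) g); last exact: cg.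
  by apply: cvgD; [exact: cvg_id|exact: cvg_cst].
apply: continuous_compact_integrable; first exact: segment_compact.
by apply: continuous_subspaceT; exact: cgy.
Qed.

Let integrable_const (c : R) : mu.-integrable `[0, n%:R^-1] (EFin \o (cst c)).
Proof.
apply: continuous_compact_integrable; first exact: segment_compact.
by apply: continuous_subspaceT => h; exact: cvg_cst.
Qed.

Let running_mean_const (c : R) : n%:R * \int[mu]_(h in `[0, n%:R^-1]) c = c.
Proof.
have muE : lebesgue_measure `[0, n%:R^-1 : R] = (n%:R^-1)%:E.
  by rewrite lebesgue_measure_itv/= lte_fin invr_gt0 nR0 oppr0 adde0.
by rewrite Rintegral_cst// [X in fine X]muE/= mulrCA divff ?mulr1// gt_eqF.
Qed.

Lemma forward_average_running_mean : forward_average n%:R^-1 running_mean.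
Proof.
split.
- move=> g [cg [M gM]] y; apply: cvgM; first exact: cvg_cst.
  (* The constant M dominates on the bounded interval of integration; the parameter ranges over a
     neighbourhood of y of radius 1. *)
  apply: (@continuity_under_integral _ _ _ mu
    (fun (z : R) (h : measurableTypeR R) => g ((h : R) + z)) _ mI
    (y - 1) (y + 1) _ _ (cst M)) => //.
  + by move=> z _; exact: integrable_shift.
  + apply: aeW => h _ z _.
    apply: (@cvg_comp _ _ _ (fun z => h + z) g); last exact: cg.
    by apply: cvgD; [exact: cvg_cst|exact: cvg_id].
  + by move=> z _; apply: aeW.
  + by rewrite inE/= in_itv/=; lra.
- move=> g h [cg _] [ch _]; apply/funext => y.
  by rewrite /running_mean /= -mulrBr -RintegralB//; exact: integrable_shift.
- move=> g c e y [cg _] gce.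
  (* Both constants are written as their own means, and the integrands are compared pointwise. *)
  rewrite -[c]running_mean_const -[leRHS]running_mean_const /running_mean -mulrBr.
  rewrite normrM (ger0_norm (ltW nR0)); apply: ler_wpM2l; first exact: ltW.
  have gint := integrable_shift y cg; have cint := integrable_const c.
  have gcint := integrableB mI gint cint.
  rewrite -(RintegralB mI gint cint).
  apply: (le_trans (le_normr_Rintegral mI gcint)).
  apply: (le_Rintegral mI (integrable_norm gcint) (integrable_const e)) => h.
  by rewrite /= in_itv/= => h01; rewrite [h + y]addrC gce.
Qed.

End forward_average.

(** * The operator [Bop] as an integral against [Psi], and its rate of approximation *)

Section Bop_theory.
Context (R : realType) (q beta : R) (n : nat).
Hypotheses (q0 : 0 < q) (beta0 : 0 < beta) (n0 : (0 < n)%N).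
Implicit Types f g h : R -> R.
Local Notation mu := (@lebesgue_measure R).
Local Notation Psi := (Psi q beta).

Let nR0 : 0 < n%:R :> R. Proof. by rewrite ltr0n. Qed.

Lemma integrableM_Psi h (M : R) :
  measurable_fun [set: measurableTypeR R] h ->
  (forall u, `|h u| <= M) -> mu.-integrable setT (EFin \o (fun u => h u * Psi u)).
Proof.
move=> mh hM; apply: (integrableMr measurableT mh _ (Psi_integrable q0 beta0)).
by exists M; split; [exact: num_real|move=> N MN x _; exact: le_trans (ltW MN)].
Qed.

Let continuous_scaled g (x : R) : continuous g ->
  continuous (fun u : R => g (x - u / n%:R)).
Proof.
move=> cg u; apply: (@cvg_comp _ _ _ (fun u => x - u / n%:R) g); last exact: cg.
apply: cvgB; first exact: cvg_cst.
by apply: cvgM; [exact: cvg_id|exact: cvg_cst].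
Qed.

Let integrable_Bop g (x : R) : bounded_continuous g ->
  mu.-integrable setT (EFin \o (fun u => g (x - u / n%:R) * Psi u)).
Proof.
move=> [cg [M gM]]; apply: (@integrableM_Psi _ M) => //.
by apply: continuous_measurable_fun; exact: continuous_scaled.
Qed.

(** Substitution v = n x - u. The kernel no longer depends on x, and |u| / n is the distance from x
    to the evaluation point. *)
Lemma BopE g (x : R) : bounded_continuous g ->
  Bop q beta n g x = \int[mu]_u (g (x - u / n%:R) * Psi u).
Proof.
move=> [cg _]; rewrite /Bop.
rewrite -(@Rintegral_reflect _ (fun u => g (x - u / n%:R) * Psi u) (n%:R * x)).
  apply: eq_Rintegral => v _; congr (g _ * _).
  by field; rewrite gt_eqF.
apply: continuous_measurable_fun => u; apply: cvgM.
- exact: continuous_scaled.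
- exact: Psi_continuous.
Qed.

(** The right tail of [Psi], extended by 0 to the whole line so that one pointwise inequality can be
    integrated in [Bop_bound]; u |-> [tail T (- u)] is the left tail, as [Psi] is even. *)
Let tail (T u : R) : R := \1_(`[T, +oo[%classic : set R) u * Psi u.

Let tail_ge0 T u : 0 <= tail T u.
Proof. by rewrite /tail mulr_ge0// Psi_ge0. Qed.

Let indic_le1 (A : set R) u : `|\1_A u : R| <= 1.
Proof. by rewrite ger0_norm// indicE; case: (_ \in _). Qed.

Let measurable_tail T : measurable_fun [set: measurableTypeR R] (tail T).
Proof. by apply: measurable_funM => //; exact: Psi_measurable. Qed.

Let integrable_tail T : mu.-integrable setT (EFin \o tail T).
Proof.
by apply: (@integrableM_Psi (\1_(`[T, +oo[%classic : set R)) 1).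
Qed.

Let integrable_tailN T :
  mu.-integrable setT (EFin \o (fun u : R => tail T (- u))).
Proof.
have -> : (fun u => tail T (- u)) =
    fun u : R => \1_(`[T, +oo[%classic : set R) (- u) * Psi u.
  by apply/funext => u; rewrite /tail Psi_even.
apply: (@integrableM_Psi (fun u : R => \1_(`[T, +oo[%classic : set R) (- u)) 1).
  by apply: measurableT_comp; [exact: measurable_indic|exact: oppr_measurable].
by move=> u; exact: indic_le1.
Qed.

Let Rintegral_tails T : \int[mu]_u (tail T u + tail T (- u)) <=
  (q + q^-1) * expR (- (beta * (T - 1))).
Proof.
rewrite (RintegralD measurableT (integrable_tail T) (integrable_tailN T)).
have -> : \int[mu]_u tail T (- u) = \int[mu]_u tail T u.
  rewrite -(Rintegral_reflect 0 (measurable_tail T)).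
  by apply: eq_Rintegral => u _; rewrite sub0r.
have -> : \int[mu]_u tail T u = \int[mu]_(u in `[T, +oo[) Psi u.
  rewrite [RHS]Rintegral_mkcond; apply: eq_Rintegral => u _.
  by rewrite /tail patchE indicE; case: ifPn => _; rewrite ?mul1r ?mul0r.
by rewrite -mulr2n -mulr_natl Psi_tail.
Qed.

Let tails_far (T u : R) : T < `|u| -> Psi u <= tail T u + tail T (- u).
Proof.
have [u0|u0] := lerP 0 u => uT.
  rewrite ger0_norm// in uT.
  rewrite -[leLHS]addr0 lerD// /tail indicE mem_set ?mul1r//=.
  by rewrite in_itv/= andbT ltW.
rewrite ltr0_norm// in uT.
rewrite -[leLHS]add0r lerD// /tail indicE mem_set ?mul1r ?Psi_even//=.
by rewrite in_itv/= andbT ltW.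
Qed.

(** By unit mass c is the integral of c [Psi]. The error is at most e [Psi] for |u| <= T, and the
    excess d is charged to the tails only. The constant c is free: c = f x serves for g = S f, and c
    = 0 gives the contraction property. *)
Lemma Bop_bound g (x c e d T : R) : bounded_continuous g -> 0 <= d ->
  (forall y, `|x - y| <= T / n%:R -> `|g y - c| <= e) ->
  (forall y, `|g y - c| <= e + d) ->
  `|Bop q beta n g x - c| <=
  e + d * ((q + q^-1) * expR (- (beta * (T - 1)))).
Proof.
move=> gC d0 gnear gfar; rewrite BopE//.
have pointwise u : `|g (x - u / n%:R) * Psi u - c * Psi u| <=
    e * Psi u + d * (tail T u + tail T (- u)).
  have P0 := Psi_ge0 q0 beta0 u.
  rewrite -mulrBl normrM (ger0_norm P0).
  have [uT|uT] := lerP `|u| T.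
    apply: (@le_trans _ _ (e * Psi u)).
      rewrite ler_wpM2r// gnear// opprB addrC subrK normrM.
      have nV0 : 0 <= n%:R^-1 :> R by rewrite invr_ge0 ltW.
      by rewrite (ger0_norm nV0) ler_wpM2r.
    by rewrite lerDl mulr_ge0// addr_ge0.
  rewrite (le_trans (ler_wpM2r P0 (gfar _)))// mulrDl lerD2l ler_wpM2l//.
  exact: tails_far.
have Pconst (a : R) : \int[mu]_u (a * Psi u) = a.
  by rewrite RintegralZl ?Psi_Rintegral ?mulr1//; exact: Psi_integrable.
have constint a : mu.-integrable setT (EFin \o (fun u => a * Psi u)).
  by apply: (@integrableM_Psi (cst a) `|a|).
have gint := integrable_Bop x gC.
have gcint := integrableB measurableT gint (constint c).
have tint := integrableD measurableT (integrable_tail T) (integrable_tailN T).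
have dtint := integrableZl measurableT d tint.
have absle := le_normr_Rintegral measurableT gcint.
rewrite -[in leLHS](Pconst c) -(RintegralB measurableT gint (constint c)).
apply: (le_trans absle).
apply: (le_trans (le_Rintegral measurableT (integrable_norm gcint)
  (integrableD measurableT (constint e) dtint) (fun u _ => pointwise u))).
rewrite (RintegralD measurableT (constint e) dtint) Pconst lerD2l.
rewrite (RintegralZl _ measurableT tint).
exact: (ler_wpM2l d0 (Rintegral_tails T)).
Qed.

Lemma BopB g h : bounded_continuous g -> bounded_continuous h ->
  Bop q beta n (g \- h) = Bop q beta n g \- Bop q beta n h.
Proof.
move=> gC hC; apply/funext => x.
have ghC := bounded_continuousB gC hC.
rewrite /= !BopE// -RintegralB//; [|exact: integrable_Bop..].
by apply: eq_Rintegral => u _; rewrite mulrBl.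
Qed.

Lemma Bop_norm_le g (M x : R) : bounded_continuous g ->
  (forall y, `|g y| <= M) -> `|Bop q beta n g x| <= M.
Proof.
move=> gC gM.
rewrite -[Bop _ _ _ _ _]subr0 -[leRHS]addr0.
(* With d = 0 the tail term vanishes, so the splitting point T = 0 is an arbitrary choice. *)
rewrite -[X in M + X](mul0r ((q + q^-1) * expR (- (beta * (0 - 1))))).
by apply: Bop_bound => // y; rewrite subr0 ?addr0.
Qed.

Lemma Bop_continuous g : bounded_continuous g -> continuous (Bop q beta n g).
Proof.
move=> gC; have [cg [M gM]] := gC.
rewrite (_ : Bop q beta n g = fun x => \int[mu]_u (g (x - u / n%:R) * Psi u));
  last by apply/funext => x; exact: BopE.
move=> x.
(* M [Psi] dominates uniformly in x, because x enters through g alone. *)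
apply: (@continuity_under_integral _ _ _ mu
  (fun x u => g (x - u / n%:R) * Psi u) setT measurableT (x - 1) (x + 1)
  _ _ (fun u => M * Psi u)).
- by move=> y _; exact: integrable_Bop.
- apply: aeW => u _ y _; apply: cvgM; last exact: cvg_cst.
  apply: (@cvg_comp _ _ _ (fun y => y - u / n%:R) g); last exact: cg.
  by apply: cvgB; [exact: cvg_id|exact: cvg_cst].
- exact: (@integrableM_Psi _ `|M|).
- move=> y _; apply: aeW => u _.
  by rewrite normrM (ger0_norm (Psi_ge0 q0 beta0 u)) ler_wpM2r// Psi_ge0.
- by rewrite inE/= in_itv/=; lra.
Qed.

(** Common form of the three estimates: f is evaluated within n^-alpha of x by the splitting of the
    integral, plus a shift of at most delta by the average. *)
Lemma Bop_average_iter (S L : (R -> R) -> R -> R) (delta alpha : R) (r : nat) f :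
  forward_average delta S -> 0 <= delta ->
  (forall g, bounded_continuous g -> L g = Bop q beta n (S g)) ->
  bounded_continuous f ->
  sup_norm (iter r L f \- f) <= r%:R * sup_norm (L f \- f)
    <= r%:R * (modulus f (delta + 1 / n%:R `^ alpha)
             + 2 * (q + 1 / q) * sup_norm f
               / expR (beta * (n%:R `^ (1 - alpha) - 1))).
Proof.
move=> [Scont SB Savg] delta0 LE fC.
(* The averaging property with c = 0. *)
have Sle g M y : bounded_continuous g -> (forall x, `|g x| <= M) -> `|S g y| <= M.
  move=> gC gM; rewrite -[S g y]subr0; apply: Savg => // t _.
  by rewrite subr0.
have SC g : bounded_continuous g -> bounded_continuous (S g).
  move=> gC; split; first exact: Scont.
  by have [_ [M gM]] := gC; exists M => x; exact: Sle.
have LC g : bounded_continuous g -> bounded_continuous (L g).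
  move=> gC; rewrite LE//; split; first exact/Bop_continuous/SC.
  have [_ [M gM]] := gC; exists M => x; apply: Bop_norm_le; first exact: SC.
  by move=> y; exact: Sle.
apply/andP; split.
  apply: sup_norm_iter_le => //.
    move=> g h gC hC; rewrite !LE ?SB ?BopB//; [exact: SC..|].
    exact: bounded_continuousB.
  move=> g gC; apply: sup_norm_le => x; rewrite LE//.
  apply: Bop_norm_le; first exact: SC.
  by move=> y; apply: Sle => // z; apply: ler_sup_norm; case: gC.
have [_ fb] := fC.
have nf0 : 0 <= sup_norm f := le_trans (normr_ge0 (f 0)) (ler_sup_norm 0 fb).
have na0 : 0 < n%:R `^ alpha by rewrite powR_gt0.
have theta0 : 0 <= delta + 1 / n%:R `^ alpha.
  by rewrite addr_ge0// divr_ge0// ltW.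
(* This puts the trivial far bound 2 ||f|| below e + d when e is the modulus and d = 2 ||f||. *)
have m0 : 0 <= modulus f (delta + 1 / n%:R `^ alpha).
  apply: (le_trans (normr_ge0 (f 0 - f 0))); apply: ler_modulus => //.
  by rewrite subrr normr0.
rewrite ler_wpM2l//; apply: sup_norm_le => x /=; rewrite LE//.
have -> : 2 * (q + 1 / q) * sup_norm f / expR (beta * (n%:R `^ (1 - alpha) - 1)) =
    2 * sup_norm f * ((q + q^-1) * expR (- (beta * (n%:R `^ (1 - alpha) - 1)))).
  by rewrite expRN div1r; ring.
(* Here c = f x, e is the modulus, d = 2 ||f|| and T = n^(1 - alpha), so that T / n = n^-alpha. *)
apply: Bop_bound => //.
- exact: SC.
- by rewrite mulr_ge0.
- move=> y xy; apply: Savg => // t /andP[t0 td]; apply: ler_modulus => //.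
  have -> : y + t - x = t - (x - y) by ring.
  rewrite (le_trans (ler_normB _ _))// lerD//; first by rewrite ger0_norm.
  apply: (le_trans xy).
  rewrite powRD; last by apply/implyP => _; rewrite gt_eqF.
  by rewrite powRr1 ?ler0n// powRN mulrAC divff ?gt_eqF// div1r mul1r.
- move=> y; apply: Savg => // t _.
  apply: (le_trans (ler_normB _ _)).
  rewrite -[leLHS]add0r lerD// mulr_natl mulr2n.
  by apply: lerD; exact: ler_sup_norm.
Qed.

(** Only the position of the factor n differs. The inner integral [total] is n^-1 times the running
    mean, hence bounded and continuous, and n passes through the outer integral by linearity. *)
Lemma BstarE g : bounded_continuous g ->
  Bstar q beta n g = Bop q beta n (running_mean n g).
Proof.
move=> gC; have [cg [M gM]] := gC.
have [Scont _ Savg] := forward_average_running_mean R n0.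
have avM y : `|running_mean n g y| <= M.
  by rewrite -[running_mean n g y]subr0; apply: Savg => // t _; rewrite subr0.
pose total y := \int[mu]_(h in `[0, n%:R^-1]) g (h + y).
have totalE : total = fun y => n%:R^-1 * running_mean n g y.
  by apply/funext => y; rewrite /running_mean mulrA mulVf ?mul1r// gt_eqF.
have meanC : bounded_continuous (running_mean n g).
  by split; [exact: Scont|exists M].
have totalC : bounded_continuous total.
  rewrite totalE; split.
    by move=> y; apply: cvgM; [exact: cvg_cst|exact: Scont].
  exists (n%:R^-1 * M) => y; rewrite normrM ger0_norm ?invr_ge0//.
  by rewrite ler_wpM2l// invr_ge0.
apply/funext => x; transitivity (n%:R * Bop q beta n total x) => //.
rewrite !BopE// -RintegralZl//; last exact: integrable_Bop.
by apply: eq_Rintegral => u _; rewrite mulrA.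
Qed.

End Bop_theory.

(** * The estimates for the three operators *)

Theorem theorem14 (R : realType) (q beta alpha : R) (n r M : nat)
    (w : 'I_M -> R) (f : R -> R)
    (hq : 0 < q) (hbeta : 0 < beta) (halpha0 : 0 < alpha) (halpha1 : alpha < 1)
    (hn : (0 < n)%N) (hn2 : 2 < n%:R `^ (1 - alpha)) (hr : (0 < r)%N)
    (hM : (0 < M)%N) (hw0 : forall j : 'I_M, 0 <= w j)
    (hw1 : \sum_(j < M) w j = 1)
    (hfc : continuous f) (hfb : bounded_fun f) :
  [/\ sup_norm (iter r (Bop q beta n) f \- f)
        <= r%:R * sup_norm (Bop q beta n f \- f)
        <= r%:R * (modulus f (1 / n%:R `^ alpha)
             + 2 * (q + 1 / q) * sup_norm f
               / expR (beta * (n%:R `^ (1 - alpha) - 1))),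
      sup_norm (iter r (Bstar q beta n) f \- f)
        <= r%:R * sup_norm (Bstar q beta n f \- f)
        <= r%:R * (modulus f (1 / n%:R + 1 / n%:R `^ alpha)
             + 2 * (q + 1 / q) * sup_norm f
               / expR (beta * (n%:R `^ (1 - alpha) - 1)))
    & sup_norm (iter r (Bbar q beta w n) f \- f)
        <= r%:R * sup_norm (Bbar q beta w n f \- f)
        <= r%:R * (modulus f (1 / n%:R + 1 / n%:R `^ alpha)
             + 2 * (q + 1 / q) * sup_norm f
               / expR (beta * (n%:R `^ (1 - alpha) - 1)))].
Proof.
have fC : bounded_continuous f.
  split=> //; have [M0 [_ fM]] := hfb.
  (* [bounded_fun] gives a bound by every real strictly above M0. *)
  by exists (M0 + 1) => x; apply: fM => //; rewrite ltrDl.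
have nV0 : 0 <= n%:R^-1 :> R by rewrite invr_ge0.
split.
- have := Bop_average_iter hq hbeta hn alpha r (forward_average_id R) (lexx 0)
    (fun g _ => erefl) fC.
  by rewrite add0r.
- rewrite [X in modulus f (X + _)]div1r.
  exact: (Bop_average_iter hq hbeta hn alpha r (forward_average_running_mean R hn) nV0
    (BstarE hq hbeta hn) fC).
(* [Bbar] is by definition [Bop] of the weighted sum, hence [erefl]. *)
- rewrite [X in modulus f (X + _)]div1r.
  exact: (Bop_average_iter hq hbeta hn alpha r
    (forward_average_sum hn hM hw0 hw1) nV0 (fun g _ => erefl) fC).
Qed.
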